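(* Let $P_n$ be a path of length $n$, let $uv$ be an edge of $P_n$, and let $P'_n$ be the graph obtained from $P_n$ by removing the edge $uv$ (keeping all vertices). Degrees are taken in $P_n$. Then: (a) if $\deg(u)=\deg(v)=1$, then $meg(P'_n)=0$; (b) if $\deg(u)=1$ and $\deg(v)=2$, then $meg(P'_n)=meg(P_n)=2$; (c) if $\deg(u)=\deg(v)=2$, then $meg(P'_n)=meg(P_n)+2=4$.
   Context: Graphs are finite, undirected and simple. In a connected graph $H$, an edge $e$ is monitored by a pair of vertices $x,y$ if $e$ lies on all shortest paths between $x$ and $y$. A set $M\subseteq V(H)$ is a monitoring edge-geodetic set (MEG-set) of $H$ if every edge of $H$ is monitored by some pair of vertices of $M$; $meg(H)$ is the minimum size of a MEG-set of $H$. For a disconnected graph, a MEG-set is the union of MEG-sets of its connected components, where the MEG-set of an isolated vertex is taken to be empty; so $meg$ is the sum of the $meg$ of the components, an isolated vertex contributing $0$. *)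

(* Defs.v *)
From HB Require Import structures.
From mathcomp Require Import all_boot.
From mathcomp Require Import boolp.

Set Implicit Arguments.
Unset Strict Implicit.
Unset Printing Implicit Defensive.

Record sgraph := SGraph {
  vertex :> finType;
  edge : rel vertex;
  edge_sym : symmetric edge;
  edge_irrefl : irreflexive edge
}.

Definition deg (G : sgraph) (x : G) : nat := #|[set y | edge x y]|.

Definition connected (G : sgraph) : bool :=
  [forall x : G, [forall y : G, connect (@edge G) x y]].

Definition components (G : sgraph) : {set {set G}} :=
  [set [set y | connect (@edge G) x y] | x : G].

Section Induced.
Variables (G : sgraph) (C : {set G}).

Definition ind_edge : rel {x : G | x \in C} := fun x y => edge (val x) (val y).

Fact ind_edge_sym : symmetric ind_edge.
Proof. by move=> x y; apply: edge_sym. Qed.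

Fact ind_edge_irrefl : irreflexive ind_edge.
Proof. by move=> x; apply: edge_irrefl. Qed.

Definition induced : sgraph := SGraph ind_edge_sym ind_edge_irrefl.

End Induced.

(* The vertices x :: p form a walk from x to y of minimal length; such a walk
   has no repeated vertex. *)
Definition shortest_path (G : sgraph) (x y : G) (p : seq G) : Prop :=
  [/\ path (@edge G) x p, last x p = y &
      forall q : seq G,
        path (@edge G) x q -> last x q = y -> size p <= size q].

(* zip (x :: p) p lists the pairs of consecutive vertices of x :: p. *)
Definition on_path (G : sgraph) (a b x : G) (p : seq G) : bool :=
  ((a, b) \in zip (x :: p) p) || ((b, a) \in zip (x :: p) p).

(* Vacuously true when x and y lie in different components, so it is only
   used inside connected graphs. *)
Definition monitors (G : sgraph) (x y a b : G) : Prop :=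
  forall p : seq G, shortest_path x y p -> on_path a b x p.

Definition connected_meg_set (H : sgraph) (M : {set H}) : Prop :=
  forall a b : H, edge a b ->
    exists x y : H, [/\ x \in M, y \in M & monitors x y a b].

Definition component_meg_set (G : sgraph) (C : {set G})
    (M : {set induced C}) : Prop :=
  if #|C| == 1 then M = set0 else connected_meg_set M.

Definition meg_set (G : sgraph) (M : {set G}) : Prop :=
  if connected G then connected_meg_set M
  else exists f : forall C : {set G}, {set induced C},
    (forall C, C \in components G -> component_meg_set (f C)) /\
    M = \bigcup_(C in components G) [set val x | x in f C].

(* The default value #|G| of the minimum is harmless: it bounds the size of
   every set of vertices, and every graph has a MEG-set. *)
Definition meg (G : sgraph) : nat :=
  \big[minn/#|G|]_(M : {set G} | `[< meg_set M >]) #|M|.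

Section DelEdge.
Variables (G : sgraph) (u v : G).

Definition del_rel : rel G := fun x y =>
  edge x y && ~~ ((x == u) && (y == v) || (x == v) && (y == u)).

Fact del_rel_sym : symmetric del_rel.
Proof.
move=> x y; rewrite /del_rel edge_sym; congr (_ && ~~ _).
by rewrite orbC; congr (_ || _); rewrite andbC.
Qed.

Fact del_rel_irrefl : irreflexive del_rel.
Proof. by move=> x; rewrite /del_rel edge_irrefl. Qed.

Definition del_edge : sgraph := SGraph del_rel_sym del_rel_irrefl.

End DelEdge.

Section PathGraph.
Variable n : nat.

Definition path_rel : rel 'I_n.+1 := fun i j => (i.+1 == j) || (j.+1 == i).

Fact path_rel_sym : symmetric path_rel.
Proof. by move=> i j; rewrite /path_rel orbC. Qed.

Fact path_rel_irrefl : irreflexive path_rel.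
Proof. by move=> i; rewrite /path_rel orbb gtn_eqF. Qed.

(* Path of length n: n edges, n.+1 vertices. *)
Definition path_graph : sgraph := SGraph path_rel_sym path_rel_irrefl.

End PathGraph.

(* Main.v *)
(** A vertex of degree 1 lies in every MEG-set, since it is never an interior
    vertex of a shortest path. Conversely, in a disjoint union of paths every
    edge is monitored by the two ends of the path containing it. Hence for such
    a graph [meg] counts the vertices of degree 1, and both [P_n] and [P'_n] are
    obtained from [P_n] by cutting it after some vertex [k] ([k = n] for [P_n]
    itself). *)
Require Import Defs.
From HB Require Import structures.
From mathcomp Require Import all_boot.
From mathcomp Require Import boolp.
From mathcomp Require Import zify.

Set Implicit Arguments.
Unset Strict Implicit.
Unset Printing Implicit Defensive.

(** * Minimum size of a MEG-set *)

Lemma bigminn_le (I : eqType) (s : seq I) (P : pred I) (F : I -> nat) m j :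
  j \in s -> P j -> \big[minn/m]_(i <- s | P i) F i <= F j.
Proof.
elim: s => // i s IHs; rewrite inE big_cons => /orP[/eqP <- -> | js Pj].
  exact: geq_minl.
by case: ifP => _; rewrite ?geq_min IHs ?orbT.
Qed.

(** Inclusion in every MEG-set gives the lower bound by cardinality, so [meg] is computed without
    optimising; the default value [#|G|] of the minimum also bounds [#|M|]. *)
Lemma meg_eq_least (G : sgraph) (M : {set G}) :
  meg_set M -> (forall M' : {set G}, meg_set M' -> M \subset M') ->
  meg G = #|M|.
Proof.
move=> megM leM; apply/eqP; rewrite eqn_leq; apply/andP; split.
  by apply: bigminn_le; [apply: mem_index_enum | apply/asboolP].
apply: (big_ind (fun m => #|M| <= m)) => [|x y Mx My|M' /asboolP megM'].
- exact: max_card.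
- by rewrite leq_min Mx.
- exact/subset_leq_card/leM.
Qed.

(** * Walks and shortest paths *)

Lemma on_pathC (G : sgraph) (a b x : G) p : on_path a b x p = on_path b a x p.
Proof. by rewrite /on_path orbC. Qed.

Lemma on_path_mem (G : sgraph) (a b x : G) p : on_path a b x p -> a \in x :: p.
Proof.
have mem_zip (s t : seq G) c d : (c, d) \in zip s t -> c \in s /\ d \in t.
  elim: s t => [|c' s IHs] [|d' t] //=.
  rewrite !inE => /orP[/eqP[-> ->] | /IHs[-> ->]]; last by rewrite !orbT.
  by rewrite !eqxx.
by case/orP => /mem_zip[] // _ pa; rewrite inE pa orbT.
Qed.

Lemma on_path_map (G H : sgraph) (f : H -> G) (a b x : H) p :
  injective f ->
  on_path (f a) (f b) (f x) (map f p) = on_path a b x p.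
Proof.
move=> f_inj; rewrite /on_path -map_cons.
have -> s t : zip (map f s) (map f t) = [seq (f c.1, f c.2) | c <- zip s t].
  by elim: s t => [|c s IHs] [|d t] //=; rewrite IHs.
have ff_inj : injective (fun c : H * H => (f c.1, f c.2)).
  by move=> [c1 c2] [d1 d2] [/f_inj -> /f_inj ->].
by rewrite -(mem_map ff_inj _ (a, b)) -(mem_map ff_inj _ (b, a)).
Qed.

Lemma exists_shortest_path (G : sgraph) (x y : G) :
  connect (@edge G) x y -> exists p, shortest_path x y p.
Proof.
case/connectP => p0 p0P p0y.
pose P m := `[< exists p, [/\ path (@edge G) x p, last x p = y & size p = m] >].
have exP : exists m, P m by exists (size p0); apply/asboolP; exists p0.
case: (ex_minnP exP) => m /asboolP[p [pP py <-]] min_p.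
exists p; split=> // q qP qy; apply: min_p; apply/asboolP.
by exists q.
Qed.

Lemma shortest_path_uniq (G : sgraph) (x y : G) p :
  shortest_path x y p -> uniq (x :: p).
Proof.
(* Cutting out the loops leaves a duplicate-free walk [p'] inside [p]; by minimality [p] is no
   longer than [p'], hence duplicate-free too. *)
case=> pP <- min_p; case: (shortenP pP) min_p => p' p'P p'U sub_p' min_p.
apply: (leq_size_uniq p'U); last exact: min_p.
by move=> z; rewrite !inE => /orP[-> //|/sub_p' ->]; rewrite orbT.
Qed.

(** If [a] were not one of the two vertices monitoring [ab], it would be interior to a shortest path
    between them, and its predecessor and successor there would both be [b], a repetition. *)
Lemma pendant_in_connected_meg_set (G : sgraph) (M : {set G}) (a b : G) :
  connected G -> connected_meg_set M ->
  edge a b -> (forall z, edge a z -> z = b) -> a \in M.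
Proof.
move=> /forallP Gconn megM ab aN; have [x [y [xM yM mon]]] := megM a b ab.
have [<-//|ax] := eqVneq x a; have [<-//|ay] := eqVneq y a.
have [p pS] := exists_shortest_path (forallP (Gconn x) y).
have := on_path_mem (mon p pS); rewrite inE eq_sym (negPf ax) /= => ap.
have pU := shortest_path_uniq pS; case: pS => pP py _.
case/splitPr: ap pU pP py => p1 [|c p2] pU; rewrite last_cat /=.
  by move=> _ ya; rewrite ya eqxx in ay.
rewrite cat_path /= => /and3P[_ la /andP[ac _]] _.
rewrite edge_sym in la; move: pU.
rewrite (aN _ ac) -(aN _ la) -cat_cons cat_uniq.
case/and3P=> _ /hasP[]; exists (last x p1); last exact: mem_last.
by rewrite !inE eqxx !orbT.
Qed.

(** * Connected components and their MEG-sets *)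

Section Component.
Variables (G : sgraph) (C : {set G}).
Hypothesis compC : C \in components G.

Lemma component_closed x y : connect (@edge G) x y -> (x \in C) = (y \in C).
Proof.
move=> xy; case/imsetP: compC => z _ ->; rewrite !inE.
by apply: (same_connect_r (sym_connect_sym (@edge_sym G))).
Qed.

Lemma component_connected : connected (induced C).
Proof.
(* A walk of [G] that starts in [C] never leaves [C], so it is a walk of the induced graph. *)
have lift_path p (x : induced C) : path (@edge G) (val x) p ->
    exists2 q : seq (induced C), path (@edge (induced C)) x q & map val q = p.
  elim: p x => [|y p IHp] x /=; first by exists [::].
  case/andP=> xy yP; have yC : y \in C.
    by rewrite -(component_closed (connect1 xy)) (valP x).
  have [q qP <-] := IHp (Sub y yC) yP; exists (Sub y yC :: q) => //=.
  by rewrite qP andbT.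
have [z CE] : exists z, forall w, (w \in C) = connect (@edge G) z w.
  by case/imsetP: compC => z _ ->; exists z => w; rewrite inE.
apply/forallP=> x; apply/forallP=> y.
have : connect (@edge G) (val x) (val y).
  apply: (@connect_trans _ _ z); last by rewrite -CE (valP y).
  rewrite sym_connect_sym; last exact: edge_sym.
  by rewrite -CE (valP x).
case/connectP=> p /lift_path[q qP <-]; rewrite last_map => /val_inj ->.
by apply/connectP; exists q.
Qed.

End Component.

Lemma mem_components (G : sgraph) (a : G) :
  [set y | connect (@edge G) a y] \in components G.
Proof. exact: imset_f. Qed.

Lemma component_nontrivial (G : sgraph) (C : {set G}) (a b : G) :
  a \in C -> b \in C -> edge a b -> #|C| != 1.
Proof.
move=> aC bC ab; apply/cards1P => -[c defC]; move: aC bC ab.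
by rewrite defC !inE => /eqP-> /eqP->; rewrite edge_irrefl.
Qed.

Lemma pendant_in_meg_set (G : sgraph) (M : {set G}) (a : G) :
  meg_set M -> deg a = 1 -> a \in M.
Proof.
move=> megM /eqP/cards1P[b defN].
have edgeE z : edge a z = (z == b).
  by have /setP/(_ z) := defN; rewrite !inE.
have ab : edge a b by rewrite edgeE.
have aN z : edge a z -> z = b by rewrite edgeE => /eqP.
move: megM; rewrite /meg_set; case: ifP => [Gconn megM | _ [f [megf ->]]].
  exact: (pendant_in_connected_meg_set Gconn megM ab).
(* The component of [a] also contains [b], so the singleton convention does not apply and [a] is
   pendant in it. *)
have compC := mem_components a; set C := finset _ in compC.
have aC : a \in C by rewrite inE connect0.
have bC : b \in C by rewrite inE connect1.
apply/bigcupP; exists C => //; apply/imsetP; exists (Sub a aC) => //.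
have := megf C compC.
rewrite /component_meg_set (negPf (component_nontrivial aC bC ab)) => megC.
apply: (@pendant_in_connected_meg_set (induced C) _ _ (Sub b bC)) => //.
  exact: component_connected.
by move=> z /aN zb; apply: val_inj.
Qed.

(** Asking for the edge on all walks, not only on shortest ones, makes the condition pass from [G]
    to the components, since a walk in a component is a walk in [G]. The first hypothesis keeps
    isolated vertices out of [M], as the convention for singleton components demands. *)
Lemma meg_set_of_walks (G : sgraph) (M : {set G}) :
  (forall x, x \in M -> exists y, edge x y) ->
  (forall a b : G, edge a b -> exists x y, [/\ x \in M, y \in M,
     connect (@edge G) a x, connect (@edge G) a y &
     forall p, path (@edge G) x p -> last x p = y -> on_path a b x p]) ->
  meg_set M.
Proof.
move=> Mnbr Mwalk; rewrite /meg_set; case: ifP => [_ a b ab|_].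
  have [x [y [xM yM _ _ xyP]]] := Mwalk a b ab.
  by exists x, y; split=> // p [pP py _]; apply: xyP.
exists (fun C : {set G} =>
  if #|C| == 1 then set0 else [set x : induced C | val x \in M]).
split=> [C compC|]; last first.
  apply/setP=> x; apply/idP/bigcupP => [xM | [C _]]; last first.
    by case: ifP => _ /imsetP[z]; rewrite !inE // => zM ->.
  have [y xy] := Mnbr x xM; exists [set y | connect (@edge G) x y].
    exact: mem_components.
  have xC : x \in [set y | connect (@edge G) x y] by rewrite inE connect0.
  have yC : y \in [set y | connect (@edge G) x y] by rewrite inE connect1.
  rewrite (negPf (component_nontrivial xC yC xy)).
  by apply/imsetP; exists (Sub x xC); rewrite ?inE.
rewrite /component_meg_set; case: (#|C| == 1) => // a b ab.
have [x [y [xM yM ax ay xyP]]] := Mwalk _ _ ab.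
have xC : x \in C by rewrite -(component_closed compC ax) (valP a).
have yC : y \in C by rewrite -(component_closed compC ay) (valP a).
pose x' : induced C := Sub x xC; pose y' : induced C := Sub y yC.
exists x', y'; rewrite !inE; split=> // p [pP py _].
rewrite -(@on_path_map G (induced C) val) //; last exact: val_inj.
apply: xyP; last by rewrite -[x]/(val x') last_map py.
by rewrite -[x]/(val x') path_map.
Qed.

(** * Crossing edges and indicator sums *)

Lemma walk_crosses (G : sgraph) (S : pred G) (x : G) p :
  path (@edge G) x p -> S x -> ~~ S (last x p) ->
  exists c d, [/\ (c, d) \in zip (x :: p) p, edge c d, S c & ~~ S d].
Proof.
elim: p x => [|y p IHp] x /=; first by move=> _ ->.
(* The edge sought is the first step of the walk that leaves [S]. *)
case/andP=> xy yP Sx Sl; have [Sy|Sy] := boolP (S y); last first.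
  by exists x, y; rewrite inE eqxx.
by have [c [d [cd *]]] := IHp y yP Sy Sl; exists c, d; rewrite inE cd orbT.
Qed.

Lemma card_set_sum (T : finType) (P : pred T) : #|[set x | P x]| = \sum_x P x.
Proof.
by rewrite -sum1_card big_mkcond; apply: eq_bigr => x _;
  rewrite inE; case: (P x).
Qed.

(** Since [m] is a natural number and not an ordinal, an index out of range simply contributes 0;
    this absorbs the boundary cases below. *)
Lemma sum_ord_eqn n m (c : bool) :
  \sum_(y < n) ((y == m :> nat) && c) = (m < n) && c.
Proof.
have [mn|nm] := ltnP m n; last first.
  by rewrite big1 // => y _; have := ltn_ord y; lia.
rewrite (bigD1 (Ordinal mn)) //= eqxx big1 ?addn0 // => y.
by rewrite -val_eqE /= => /negPf->.
Qed.

(** * Paths cut after a vertex *)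

Section CutPath.
Variables (n : nat) (e : rel 'I_n.+1).
Hypotheses (e_sym : symmetric e) (e_irrefl : irreflexive e).
Variable k : 'I_n.+1.
(** The relation [e] stays abstract so that the results apply both to [path_rel] and to
    [del_rel]. *)
Hypothesis eE : forall x y, e x y =
  ((x.+1 == y) || (y.+1 == x)) && ((x <= k) == (y <= k)).
Let G := SGraph e_sym e_irrefl.

(** The summands count the left and the right neighbour: the left one is missing at [0] and just
    after the cut, the right one at [n] and just before it. *)
Lemma deg_cut_path (x : G) :
  deg x = ((0 < x) && (x != k.+1 :> nat)) + ((x < n) && (x != k :> nat)).
Proof.
have := ltn_ord x => xn; rewrite /deg card_set_sum.
under eq_bigr => y _.
  (* The guard [0 < x] is there because [x.-1] is [0] at [x = 0]; at [x = n] the index [x.+1] falls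
     out of range. *)
  rewrite (_ : nat_of_bool _ =
      ((y == x.-1 :> nat) && ((0 < x) && (x != k.+1 :> nat)))
    + ((y == x.+1 :> nat) && (x != k :> nat)));
    last by rewrite [edge x y]eE; lia.
  over.
by rewrite big_split !sum_ord_eqn /=; lia.
Qed.

Lemma connect_cut_path (x y : G) :
  (x <= k) = (y <= k) -> connect (@edge G) x y.
Proof.
wlog le_xy : x y / x <= y => [IH xy|].
  have [/IH|/ltnW/IH yx] := leqP x y; first exact.
  by rewrite sym_connect_sym ?yx //; apply: edge_sym.
(* Induction on the distance [y - x]: the successor of [x] is at most [y], hence on the same side of
   the cut. *)
move: {2}(y - x) (erefl (y - x)) => m; elim: m x le_xy => [|m IHm] x xy yx same.
  by rewrite (_ : x = y) ?connect0 //; apply: val_inj; simpl; lia.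
have xn : x.+1 < n.+1 by have := ltn_ord y; lia.
apply: (connect_trans (y := Ordinal xn : G)); last by apply: IHm => /=; lia.
by apply: connect1; rewrite [edge _ _]eE /=; lia.
Qed.

Lemma meg_cut_path_leaves : meg G = #|[set x : G | deg x == 1]|.
Proof.
apply: meg_eq_least => [|M megM]; last first.
  apply/subsetP=> x; rewrite inE => /eqP.
  exact: pendant_in_meg_set.
apply: meg_set_of_walks => [x|a b ab].
  by rewrite inE => /cards1P[y /setP/(_ y)]; rewrite !inE eqxx; exists y.
wlog lt_ab : a b ab / a < b => [IH|].
  have [/(IH _ _ ab)//|ba] := ltnP a b.
  have {IH} [||x [y [xM yM bx by_ mon]]] := IH b a.
  - by rewrite edge_sym.
  - by move: ab; rewrite [edge _ _]eE; lia.
  exists x, y; split=> // [||p pP py];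
    try by apply: connect_trans (connect1 ab) _.
  by rewrite on_pathC; apply: mon.
have [ab1 same] : b = a.+1 :> nat /\ (a <= k) = (b <= k).
  by move: ab; rewrite [edge _ _]eE; lia.
have bn := ltn_ord b.
(* The only edge joining the vertices up to [a] to those beyond [a] is [ab]. *)
have crosses (x y : G) : x <= a -> a < y ->
    forall p, path (@edge G) x p -> last x p = y -> on_path a b x p.
  move=> xa ay p pP py.
  have [||c [d [cd cdE ca da]]] := @walk_crosses _ (fun z : G => z <= a) _ _ pP.
  - exact: xa.
  - by rewrite py -ltnNge.
  have [-> ->] : a = c /\ b = d.
    by split; apply: val_inj; simpl; move: cdE; rewrite [edge _ _]eE; lia.
  by rewrite /on_path cd.
(* The monitoring pair consists of the ends of the piece containing [ab]: [0] and [k] before the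
   cut, [k.+1] and [n] after it. *)
have [bk|kb] := leqP b k.
  exists (ord0 : G), k; split; rewrite ?inE ?deg_cut_path /=; try lia.
  - by apply: connect_cut_path => /=; lia.
  - by apply: connect_cut_path => /=; lia.
  - by apply: crosses => /=; lia.
have kn : k.+1 < n.+1 by lia.
exists (Ordinal kn : G), (ord_max : G).
split; rewrite ?inE ?deg_cut_path /=; try lia.
- by apply: connect_cut_path => /=; lia.
- by apply: connect_cut_path => /=; lia.
- by apply: crosses => /=; lia.
Qed.

Lemma meg_cut_path : meg G = (0 < k).*2 + (k.+1 < n).*2.
Proof.
rewrite meg_cut_path_leaves card_set_sum; have := ltn_ord k => kn.
under eq_bigr => x _.
  (* The leaves are the ends of the pieces having an edge. Under the guards the two ends of a piece
     differ, so the four indicators never overlap. *)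
  rewrite (_ : nat_of_bool _ =
      ((x == 0 :> nat) && (0 < k)) + ((x == k :> nat) && (0 < k))
    + (((x == k.+1 :> nat) && (k.+1 < n)) + ((x == n :> nat) && (k.+1 < n))));
    last by have := ltn_ord x; rewrite deg_cut_path; lia.
  over.
by rewrite !big_split !sum_ord_eqn /=; lia.
Qed.

End CutPath.

(** * The path and the path minus an edge *)

Lemma deg_path_graph n (x : path_graph n) : deg x = (0 < x) + (x < n).
Proof.
have xn := ltn_ord x.
(* Cutting after the last vertex [ord_max] removes no edge. *)
rewrite (@deg_cut_path _ _ (@path_rel_sym n) (@path_rel_irrefl n) ord_max) /=.
  by lia.
by move=> y z; have := ltn_ord y; have := ltn_ord z; rewrite /path_rel /=; lia.
Qed.

Lemma meg_path_graph n : meg (path_graph n) = (0 < n).*2.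
Proof.
rewrite (@meg_cut_path _ _ (@path_rel_sym n) (@path_rel_irrefl n) ord_max) /=.
  by lia.
by move=> y z; have := ltn_ord y; have := ltn_ord z; rewrite /path_rel /=; lia.
Qed.

Lemma meg_del_edge_path n (u v : path_graph n) : edge u v ->
  meg (del_edge u v) = (0 < minn u v).*2 + (maxn u v < n).*2.
Proof.
move=> uv; have {}uv : u.+1 = v \/ v.+1 = u.
  by move: uv; rewrite /= /path_rel => /orP[] /eqP; [left | right].
have un := ltn_ord u; have vn := ltn_ord v.
(* The cut comes after the smaller endpoint of [uv]; the larger one is its successor and starts the
   second piece. *)
have kn : minn u v < n.+1 by lia.
rewrite (@meg_cut_path _ _ (@del_rel_sym _ u v) (@del_rel_irrefl _ u v)
  (Ordinal kn)) /=; first by lia.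
by move=> y z; rewrite /del_rel /= /path_rel -!val_eqE /=; lia.
Qed.

Theorem corollary3p2 (n : nat) (u v : path_graph n) (huv : edge u v) :
  [/\ deg u = 1 -> deg v = 1 -> meg (del_edge u v) = 0,
      deg u = 1 -> deg v = 2 ->
        meg (del_edge u v) = meg (path_graph n) /\ meg (path_graph n) = 2
    & deg u = 2 -> deg v = 2 ->
        meg (del_edge u v) = meg (path_graph n) + 2 /\
        meg (path_graph n) + 2 = 4].
Proof.
rewrite meg_del_edge_path // meg_path_graph !deg_path_graph.
have un := ltn_ord u; have vn := ltn_ord v.
have {}huv : u.+1 = v \/ v.+1 = u.
  by move: huv; rewrite /= /path_rel => /orP[] /eqP; [left | right].
(* With [u] and [v] consecutive, the degrees force [n = 1] in the first case, [u] an end and [1 < n]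
   in the second, and both endpoints interior in the third. *)
by split; lia.
Qed.
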